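(* Let $\kappa\in\mathbb{R}$, $\tau\ge0$, $\kappa\ne4\tau^2$, let the pitch $a$ be admissible, and let $\mathcal{T}_a=\{T_a(\mu):\mu\in(0,\infty)\}$ be a tube family of pitch $a$ in $\mathbb{E}(\kappa,\tau)$. Then $\mathcal{T}_a$ converges in distance, as $\mu\to\infty$, to the geodesic $c_a(s)=(\rho_a,s,as)$, where $$\mathrm{cs}_\kappa(\rho_a)=\frac{\kappa}{\kappa-4\tau^2}(2a\tau-1)+1$$ (for $\kappa=0$ understood as the limit $\kappa\to0$, i.e. $\rho_a^2=\frac{2a\tau-1}{2\tau^2}$).
   Context: Ambient space. Put $\varepsilon=\operatorname{sgn}(\kappa-4\tau^2)$. Let $\mathrm{sn}_\kappa(r)=\frac{1}{\sqrt\kappa}\sin(\sqrt\kappa r),\ r,\ \frac{1}{\sqrt{-\kappa}}\sinh(\sqrt{-\kappa}r)$ and $\mathrm{cs}_\kappa(r)=\cos(\sqrt\kappa r),\ 1,\ \cosh(\sqrt{-\kappa}r)$ for $\kappa>0$, $\kappa=0$, $\kappa<0$ respectively. $\mathbb{E}(\kappa,\tau)$ is the homogeneous 3-manifold fibering over the simply connected surface of curvature $\kappa$ with geodesic fibers and bundle curvature $\tau$; it is modelled (up to a fiberwise covering and removal of the fiber(s) over $r=0$ and, if $\kappa>0$, $r=\pi/\sqrt\kappa$) by $(r,\theta,z)\in I_\kappa\times[0,2\pi)\times\mathbb{R}$, $\theta$ taken modulo $2\pi$, with $I_\kappa=(0,\infty)$ if $\kappa\le0$ and $(0,\pi/\sqrt\kappa)$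 if $\kappa>0$, and metric $dr^2+\mathrm{sn}_\kappa^2(r)d\theta^2+(4\tau\,\mathrm{sn}_\kappa^2(\frac r2)d\theta-dz)^2$. The screw motion group of pitch $a\in\mathbb{R}$ is $G_a=\{(r,\theta,z)\mapsto(r,\theta+s,z+as):s\in\mathbb{R}\}$; $(r,h)$ are coordinates on the orbit space. The pitch $a$ is admissible if $a\tau\varepsilon\in(-\infty,\frac\varepsilon2)$ when $\kappa\le0$, or $a\tau\varepsilon\in[\frac{2\tau^2\varepsilon}{\kappa},\frac\varepsilon2)$ when $\kappa>0$; then $c_a$ is a geodesic orbit of $G_a$. Surfaces. Let $\Xi=\{(H,J):H>0,\ J\in(-\frac{4H}{\kappa},0)\}$ if $\kappa>0$ and $\Xi=\{(H,J):H>\frac{\sqrt{-\kappa}}2,\ J<0\}$ if $\kappa\le0$. For $(H,J)\in\Xi$ and $\sigma\in\mathbb{R}$ let $r(\sigma)\in I_\kappa$ be the unique solution of $\frac{2H}{\kappa}(\mathrm{cs}_\kappa(r)-1)+\mathrm{sn}_\kappa(r)\sin\sigma=J$ (for $\kappa=0$: $-Hr^2+r\sin\sigma=J$) and $$h_a(\sigma)=\int_{\pi/2}^\sigma\frac{dh}{d\sigma}\,d\sigma,\qquad \frac{dh}{d\sigma}=\frac{\sqrt{\mathrm{sn}_\kappa^2(r)+(4\tau\,\mathrm{sn}_\kappa^2(\frac r2)-a)^2}}{2H\,\mathrm{sn}_\kappa(r)-\mathrm{cs}_\kappa(r)\sin\sigma}\sin\sigma .$$ The profile curve is $\sigma\mapsto(r(\sigma),h_a(\sigma))$;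 the surface $\Sigma_a(H,J)=\{(r(\sigma),s,h_a(\sigma)+as)\}$ is $G_a$-invariant with constant mean curvature $H$. Closing defect: $\delta_a(H,J)=\int_{\pi/2}^{3\pi/2}\frac{dh}{d\sigma}d\sigma$. $\Sigma_a(H,J)$ is a (screw motion) tube if its profile curve is a simple closed curve, equivalently $\delta_a(H,J)=0$. Tube region: $\Theta_a=\delta_a^{-1}(0)\subseteq\Xi$. Tube family. Let $\overline\Theta_a$ be the closure of $\Theta_a$ in the closure of $\Xi$ and $\partial\Theta_a=\overline\Theta_a\setminus\Theta_a$. A tube family is $\mathcal{T}_a=\{T_a(\mu)=\Sigma_a(H(\mu),J(\mu)):\mu\in(0,\infty)\}$, where $\mu\mapsto(H(\mu),J(\mu))$, $[0,\infty)\to\overline\Theta_a$, is a continuous curve with $(H(\mu),J(\mu))\in\Theta_a$ for $\mu>0$, $(H(0),J(0))\in\partial\Theta_a$, and $(H(\mu),J(\mu))\to(\infty,-\infty)$ as $\mu\to\infty$ (such a curve exists, parameterizing a subset of $\Theta_a$; it need not be unique, and one such choice is fixed). If $2\tau^2-a\tau\kappa=0$, then $\Theta_a=\{(H,-\frac{2H}\kappa):H>0\}$ and one takes $H(\mu)=\mu$, $J(\mu)=-\frac{2\mu}\kappa$. Convergence in distance to $c_a$ means that the profile curves converge uniformly to the point $(\rho_a,0)$ of the orbit space, so that the distance of the points of $T_a(\mu)$ to $c_a$ tends uniformly to $0$. *)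

(* Defs.v *)
From Stdlib Require Import Reals ZArith.
From Coquelicot Require Export Coquelicot.
Open Scope R_scope.

Definition sn (kappa r : R) : R :=
  if Rlt_dec 0 kappa then sin (sqrt kappa * r) / sqrt kappa
  else if Rlt_dec kappa 0 then sinh (sqrt (- kappa) * r) / sqrt (- kappa)
  else r.

Definition cs (kappa r : R) : R :=
  if Rlt_dec 0 kappa then cos (sqrt kappa * r)
  else if Rlt_dec kappa 0 then cosh (sqrt (- kappa) * r)
  else 1.

(** The interval [I_kappa] of radii. *)
Definition radii (kappa r : R) : Prop :=
  0 < r /\ (0 < kappa -> r < PI / sqrt kappa).

(** Points of the model of [E(kappa,tau)] are triples [(r, theta, z)]; the angle
    is a real number, and is identified modulo [2 * PI] in [path] below. *)
Definition point : Type := (R * R * R)%type.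

(** Squared length of the vector [(dr, dtheta, dz)] at a point of radius [r]
    (the metric depends on [r] only). *)
Definition metric (kappa tau r dr dtheta dz : R) : R :=
  dr ^ 2 + (sn kappa r) ^ 2 * dtheta ^ 2
  + (4 * tau * (sn kappa (r / 2)) ^ 2 * dtheta - dz) ^ 2.

Definition C1_on_unit (f : R -> R) : Prop :=
  forall t, 0 <= t <= 1 -> ex_derive f t /\ continuous (Derive f) t.

(** [C^1] paths from [p] to [q] over the unit interval, with the angular
    coordinate lifted to the real line. *)
Definition path (kappa : R) (p q : point) (r theta z : R -> R) : Prop :=
  C1_on_unit r /\ C1_on_unit theta /\ C1_on_unit z /\
  (forall t, 0 <= t <= 1 -> radii kappa (r t)) /\
  (r 0, theta 0, z 0) = p /\
  exists k : Z, (r 1, theta 1 + 2 * PI * IZR k, z 1) = q.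

Definition length (kappa tau : R) (r theta z : R -> R) : R :=
  RInt (fun t => sqrt (metric kappa tau (r t)
                         (Derive r t) (Derive theta t) (Derive z t))) 0 1.

Definition dist (kappa tau : R) (p q : point) : Rbar :=
  Glb_Rbar (fun l => exists r theta z,
    path kappa p q r theta z /\ l = length kappa tau r theta z).

(** [sign] is [Coquelicot]'s sign function, with values [-1], [0], [1]. *)
Definition admissible (kappa tau a : R) : Prop :=
  let eps := sign (kappa - 4 * tau ^ 2) in
  (0 < kappa -> 2 * tau ^ 2 * eps / kappa <= a * tau * eps) /\
  a * tau * eps < eps / 2.

Definition Xi (kappa : R) (HJ : R * R) : Prop :=
  let (H, J) := HJ in
  if Rlt_dec 0 kappa then 0 < H /\ - (4 * H / kappa) < J < 0
  else sqrt (- kappa) / 2 < H /\ J < 0.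

Definition radius_eq (kappa H J sigma r : R) : Prop :=
  (if Req_EM_T kappa 0 then - H * r ^ 2
   else 2 * H / kappa * (cs kappa r - 1)) + sn kappa r * sin sigma = J.

(** For [(H, J)] in [Xi], the solution in [I_kappa] exists and is unique, so that
    [iota] returns it. *)
Definition radius (kappa H J sigma : R) : R :=
  iota (fun r : R => radii kappa r /\ radius_eq kappa H J sigma r).

Definition dh (kappa tau a H J sigma : R) : R :=
  let r := radius kappa H J sigma in
  sqrt ((sn kappa r) ^ 2 + (4 * tau * (sn kappa (r / 2)) ^ 2 - a) ^ 2)
  / (2 * H * sn kappa r - cs kappa r * sin sigma) * sin sigma.

Definition height (kappa tau a H J sigma : R) : R :=
  RInt (dh kappa tau a H J) (PI / 2) sigma.

Definition profile (kappa tau a H J sigma : R) : R * R :=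
  (radius kappa H J sigma, height kappa tau a H J sigma).

(** The surface [Sigma_a(H, J)], as a set of points. *)
Definition surface (kappa tau a H J : R) (p : point) : Prop :=
  exists sigma s,
    p = (radius kappa H J sigma, s, height kappa tau a H J sigma + a * s).

(** The closing defect [delta_a(H, J)]. *)
Definition defect (kappa tau a H J : R) : R :=
  RInt (dh kappa tau a H J) (PI / 2) (3 * PI / 2).

(** [Theta_a] *)
Definition tube_region (kappa tau a : R) (HJ : R * R) : Prop :=
  Xi kappa HJ /\ defect kappa tau a (fst HJ) (snd HJ) = 0.

Definition closure (D : R * R -> Prop) (x : R * R) : Prop :=
  forall eps : posreal, exists y, D y /\ ball x eps y.

(** The boundary is the closure of [Theta_a], taken in the closure of [Xi],
    minus [Theta_a] itself. *)
Definition tube_boundary (kappa tau a : R) (x : R * R) : Prop :=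
  closure (Xi kappa) x /\ closure (tube_region kappa tau a) x /\
  ~ tube_region kappa tau a x.

(** The family [T_a(mu) = surface kappa tau a (H mu) (J mu)]; the values of [H]
    and [J] at negative numbers are irrelevant. *)
Record tube_family (kappa tau a : R) (H J : R -> R) : Prop := {
  tube_family_continuous :
    continuous_on (fun mu => 0 <= mu) (fun mu => (H mu, J mu));
  tube_family_tube :
    forall mu, 0 < mu -> tube_region kappa tau a (H mu, J mu);
  tube_family_start : tube_boundary kappa tau a (H 0, J 0);
  tube_family_lim_H : is_lim H p_infty p_infty;
  tube_family_lim_J : is_lim J p_infty m_infty;
  tube_family_special :
    2 * tau ^ 2 - a * tau * kappa = 0 ->
    forall mu, 0 <= mu -> H mu = mu /\ J mu = - (2 * mu / kappa)
}.

(** The radius [rho_a]; for [kappa = 0] the equation is the limit of the general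
    one as [kappa] tends to [0]. *)
Definition is_rho (kappa tau a rho : R) : Prop :=
  radii kappa rho /\
  if Req_EM_T kappa 0 then rho ^ 2 = (2 * a * tau - 1) / (2 * tau ^ 2)
  else cs kappa rho = kappa / (kappa - 4 * tau ^ 2) * (2 * a * tau - 1) + 1.

(** The curve [c_a], an orbit of the screw motion group of pitch [a]. *)
Definition helix (a rho s : R) : point := (rho, s, a * s).

(** Uniform convergence of the profile curves to [(rho, 0)]. *)
Definition profiles_converge (kappa tau a : R) (H J : R -> R) (rho : R) : Prop :=
  forall eps : posreal, Rbar_locally p_infty (fun mu =>
    forall sigma, ball (rho, 0) eps (profile kappa tau a (H mu) (J mu) sigma)).

(** Uniform convergence to [0] of the distance in [E(kappa,tau)] from the points
    of the surfaces to the curve. *)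
Definition distances_vanish (kappa tau a : R) (H J : R -> R) (rho : R) : Prop :=
  forall eps : posreal, Rbar_locally p_infty (fun mu =>
    forall p, surface kappa tau a (H mu) (J mu) p ->
    exists s, Rbar_lt (dist kappa tau p (helix a rho s)) eps).

Definition converges_in_distance (kappa tau a : R) (H J : R -> R) (rho : R) : Prop :=
  profiles_converge kappa tau a H J rho /\ distances_vanish kappa tau a H J rho.

(* Main.v *)
(** Put [u = 2 * sn (r / 2) ^ 2 = (1 - cs r) / kappa] and [s = sin sigma].  The equation
    of the profile curve can be solved for [u] in closed form; the denominator of
    [dh] becomes [sqrt (s ^ 2 - J * (4 * H + kappa * J))], which is even in [s], and
    the square of the speed of the orbits is quadratic in [u], with vertex at the
    versine [u0] of [rho].  Hence the closing condition says that the speeds at [s]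
    and [- s] balance on average, so that for some [s] the mean of the two values of
    [u], namely [(s ^ 2 - 2 * H * J) / (4 * H ^ 2 + kappa * s ^ 2)], equals [u0].  This
    gives [J = - 2 * H * u0 + O(1 / H)], hence [u - u0 = O(1 / H)] and [dh = O(1 / H)]
    uniformly in [sigma]; the height is periodic, so it is [O(1 / H)] too. *)

Require Import Defs.
From Stdlib Require Import Reals Lra Psatz ZArith.
From Coquelicot Require Import Coquelicot.
Open Scope R_scope.

(** * Generalized sine, cosine and versine for curvature [kappa] *)

(** Unlike [(1 - cs kappa r) / kappa], this form needs no separate case at [kappa = 0]. *)
Definition versine (kappa r : R) : R := 2 * sn kappa (r / 2) ^ 2.

(** Each nonzero sign of [kappa] comes with the scale used by [sn] and [cs], so that the square root
    can afterwards be treated as a positive number with known square. *)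
Lemma kappa_cases (kappa : R) (P : Prop) :
  (0 < kappa -> 0 < sqrt kappa -> sqrt kappa * sqrt kappa = kappa -> P) ->
  (kappa < 0 -> 0 < sqrt (- kappa) -> sqrt (- kappa) * sqrt (- kappa) = - kappa -> P) ->
  (kappa = 0 -> P) -> P.
Proof.
  intros Hp Hn Hz.
  destruct (Rtotal_order kappa 0) as [hk | [hk | hk]].
  - apply Hn; [exact hk | apply sqrt_lt_R0; lra | apply sqrt_sqrt; lra].
  - exact (Hz hk).
  - apply Hp; [lra | apply sqrt_lt_R0; lra | apply sqrt_sqrt; lra].
Qed.

Ltac case_kappa kappa :=
  apply (kappa_cases kappa);
  [ intros hk hq hqq; destruct (Rlt_dec 0 kappa) as [_ | nk]; [ | lra]
  | intros hk hq hqq; destruct (Rlt_dec 0 kappa) as [nk | _];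
    [lra | destruct (Rlt_dec kappa 0) as [_ | nk]; [ | lra]]
  | intros hk; destruct (Rlt_dec 0 kappa) as [nk | _];
    [lra | destruct (Rlt_dec kappa 0) as [nk | _]; [lra | ]] ].

Lemma sinh_double (x : R) : sinh (2 * x) = 2 * sinh x * cosh x.
Proof.
  unfold sinh, cosh.
  replace (- (2 * x)) with (- x + - x) by ring; replace (2 * x) with (x + x) by ring.
  rewrite !exp_plus; field.
Qed.

Lemma cosh_double (x : R) : cosh (2 * x) = 1 + 2 * sinh x ^ 2.
Proof.
  unfold sinh, cosh.
  replace (- (2 * x)) with (- x + - x) by ring; replace (2 * x) with (x + x) by ring.
  rewrite !exp_plus.
  assert (he : exp x * exp (- x) = 1) by (rewrite <- exp_plus, Rplus_opp_r; apply exp_0).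
  replace (exp x * exp x + exp (- x) * exp (- x)) with ((exp x - exp (- x)) ^ 2 + 2 * (exp x * exp (- x))) by ring.
  rewrite he; field.
Qed.

Lemma sn_double (kappa r : R) : sn kappa r = 2 * sn kappa (r / 2) * cs kappa (r / 2).
Proof.
  unfold sn, cs; case_kappa kappa.
  - replace (sqrt kappa * r) with (2 * (sqrt kappa * (r / 2))) by field.
    rewrite sin_2a; field; lra.
  - replace (sqrt (- kappa) * r) with (2 * (sqrt (- kappa) * (r / 2))) by field.
    rewrite sinh_double; field; lra.
  - field.
Qed.

Lemma cs_versine (kappa r : R) : cs kappa r = 1 - kappa * versine kappa r.
Proof.
  unfold versine, sn, cs; case_kappa kappa.
  - replace (sqrt kappa * r) with (2 * (sqrt kappa * (r / 2))) by field.
    rewrite cos_2a_sin.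
    set (q := sqrt kappa) in *; clearbody q; rewrite <- hqq; field; lra.
  - replace (sqrt (- kappa) * r) with (2 * (sqrt (- kappa) * (r / 2))) by field.
    rewrite cosh_double.
    set (q := sqrt (- kappa)) in *; clearbody q.
    replace kappa with (- (q * q)) by lra; field; lra.
  - subst; ring.
Qed.

Lemma cs_sn_sqr (kappa r : R) : cs kappa r ^ 2 = 1 - kappa * sn kappa r ^ 2.
Proof.
  unfold sn, cs; case_kappa kappa.
  - replace (cos (sqrt kappa * r) ^ 2) with (Rsqr (cos (sqrt kappa * r))) by (unfold Rsqr; ring).
    rewrite cos2; unfold Rsqr.
    set (q := sqrt kappa) in *; clearbody q; rewrite <- hqq; field; lra.
  - set (q := sqrt (- kappa)) in *; clearbody q.
    replace kappa with (- (q * q)) by lra.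
    set (x := q * r).
    assert (he : exp x * exp (- x) = 1) by (rewrite <- exp_plus, Rplus_opp_r; apply exp_0).
    replace (cosh x ^ 2) with (sinh x ^ 2 + exp x * exp (- x)) by (unfold cosh, sinh; field).
    rewrite he; field; lra.
  - subst; ring.
Qed.

Lemma sn_versine (kappa r : R) :
  sn kappa r ^ 2 = versine kappa r * (2 - kappa * versine kappa r).
Proof.
  rewrite sn_double, !Rpow_mult_distr, cs_sn_sqr; unfold versine; ring.
Qed.

Lemma sn_gt0 (kappa r : R) : radii kappa r -> 0 < sn kappa r.
Proof.
  intros [r0 r1]; unfold sn; case_kappa kappa.
  - specialize (r1 hk); apply Rdiv_lt_0_compat; [ | exact hq].
    apply sin_gt_0; [nra | ].
    apply (Rmult_lt_compat_l (sqrt kappa)) in r1; [ | exact hq].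
    replace (sqrt kappa * (PI / sqrt kappa)) with PI in r1 by (field; lra); exact r1.
  - apply Rdiv_lt_0_compat; [ | exact hq].
    rewrite <- sinh_0; apply sinh_lt; nra.
  - exact r0.
Qed.

Lemma radii_half (kappa r : R) : radii kappa r -> radii kappa (r / 2).
Proof.
  intros [r0 r1]; split; [lra | intros hk; specialize (r1 hk); lra].
Qed.

Lemma sn_half_lt (kappa r r' : R) :
  radii kappa r -> radii kappa r' -> r < r' -> sn kappa (r / 2) < sn kappa (r' / 2).
Proof.
  intros [r0 r1] [r0' r1'] h; unfold sn; case_kappa kappa.
  - specialize (r1' hk); apply Rmult_lt_compat_r; [now apply Rinv_0_lt_compat | ].
    apply (Rmult_lt_compat_l (sqrt kappa)) in r1'; [ | exact hq].
    replace (sqrt kappa * (PI / sqrt kappa)) with PI in r1' by (field; lra).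
    assert (hm := Rmult_lt_compat_l _ _ _ hq h).
    assert (hm0 := Rmult_lt_0_compat _ _ hq r0).
    apply sin_increasing_1; lra.
  - apply Rmult_lt_compat_r; [now apply Rinv_0_lt_compat | ].
    apply sinh_lt, Rmult_lt_compat_l; lra.
  - lra.
Qed.

Lemma versine_lt (kappa r r' : R) :
  radii kappa r -> radii kappa r' -> r < r' -> versine kappa r < versine kappa r'.
Proof.
  intros hr hr' h; unfold versine.
  assert (h1 := sn_half_lt _ _ _ hr hr' h).
  assert (h0 := sn_gt0 _ _ (radii_half _ _ hr)).
  nra.
Qed.

Lemma versine_inj (kappa r r' : R) :
  radii kappa r -> radii kappa r' -> versine kappa r = versine kappa r' -> r = r'.
Proof.
  intros hr hr' h.
  destruct (Rtotal_order r r') as [hl | [he | hl]]; [ | exact he | ].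
  - apply (versine_lt kappa) in hl; auto; lra.
  - apply (versine_lt kappa) in hl; auto; lra.
Qed.

(** The radius is obtained by inverting [sn kappa (r / 2) = sqrt (u / 2)] through [asin] or
    [arcsinh]. For positive [kappa] the versine tends to [2 / kappa] at the end of the interval, and
    [kappa * u < 2] puts the argument of [asin] below 1. *)
Lemma versine_onto (kappa u : R) :
  0 < u -> kappa * u < 2 -> exists r, radii kappa r /\ versine kappa r = u.
Proof.
  intros u0 u1.
  assert (hw : sqrt (u / 2) ^ 2 = u / 2) by (apply pow2_sqrt; lra).
  assert (w0 : 0 < sqrt (u / 2)) by (apply sqrt_lt_R0; lra).
  set (w := sqrt (u / 2)) in *.
  cut (exists r, radii kappa r /\ sn kappa (r / 2) = w).
  { intros [r [hr e]]; exists r; split; [exact hr | ].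
    unfold versine; rewrite e, hw; field. }
  unfold radii, sn; case_kappa kappa.
  - assert (hx0 : 0 < sqrt kappa * w) by nra.
    assert (hx1 : sqrt kappa * w < 1).
    { apply Rnot_le_lt; intro hge.
      assert (1 <= (sqrt kappa * sqrt kappa) * w ^ 2) by (replace (sqrt kappa * sqrt kappa * w ^ 2) with ((sqrt kappa * w) ^ 2) by ring; nra).
      rewrite hqq, hw in H; lra. }
    assert (hs := sin_asin (sqrt kappa * w) ltac:(lra)).
    assert (hb := asin_bound_lt (sqrt kappa * w) ltac:(lra)).
    assert (ha : 0 < asin (sqrt kappa * w)).
    { apply Rnot_le_lt; intro hle.
      assert (hc : sin (asin (sqrt kappa * w)) <= sin 0) by (apply sin_incr_1; lra).
      rewrite sin_0 in hc; lra. }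
    exists (2 * asin (sqrt kappa * w) / sqrt kappa).
    split; [split; [ | intros _] | ].
    + apply Rdiv_lt_0_compat; lra.
    + apply Rmult_lt_compat_r; [now apply Rinv_0_lt_compat | lra].
    + replace (sqrt kappa * (2 * asin (sqrt kappa * w) / sqrt kappa / 2)) with (asin (sqrt kappa * w)) by (field; lra).
      rewrite hs; field; lra.
  - exists (2 * arcsinh (sqrt (- kappa) * w) / sqrt (- kappa)).
    split; [split; [ | lra] | ].
    + apply Rdiv_lt_0_compat; [ | exact hq].
      assert (h := arcsinh_lt 0 (sqrt (- kappa) * w) ltac:(nra)).
      rewrite arcsinh_0 in h; lra.
    + replace (sqrt (- kappa) * (2 * arcsinh (sqrt (- kappa) * w) / sqrt (- kappa) / 2)) with (arcsinh (sqrt (- kappa) * w)) by (field; lra).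
      rewrite sinh_arcsinh; field; lra.
  - exists (2 * w); split; [split; lra | field].
Qed.

(** * Closed form of the profile radius *)

Lemma versine_flat (r : R) : versine 0 r = r ^ 2 / 2.
Proof. unfold versine, sn; case_kappa 0; lra || field. Qed.

(** In terms of the versine the flat and curved equations coincide, which ends the case distinction
    on [kappa]. *)
Lemma radius_eq_versine (kappa H J sigma r : R) :
  radius_eq kappa H J sigma r <->
  - (2 * H * versine kappa r) + sn kappa r * sin sigma = J.
Proof.
  unfold radius_eq.
  destruct (Req_EM_T kappa 0) as [-> | hk].
  - rewrite versine_flat.
    replace (- (2 * H * (r ^ 2 / 2))) with (- H * r ^ 2) by field; tauto.
  - rewrite cs_versine.
    replace (2 * H / kappa * (1 - kappa * versine kappa r - 1))
      with (- (2 * H * versine kappa r)) by (field; exact hk); tauto.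
Qed.

(** A description of [Xi] by inequalities uniform in the sign of [kappa]: the second and third make
    the radicand of [denom] positive, the first and last the determinant of the linear system
    below. *)
Lemma Xi_pos (kappa H J : R) :
  Xi kappa (H, J) -> 0 < H /\ J < 0 /\ 0 < 4 * H + kappa * J /\ 0 < 4 * H ^ 2 + kappa.
Proof.
  unfold Xi; case_kappa kappa.
  - intros [H0 [J0 J1]]; repeat split; try nra.
    apply (Rmult_lt_compat_l kappa) in J0; [ | exact hk].
    replace (kappa * - (4 * H / kappa)) with (- (4 * H)) in J0 by (field; lra); lra.
  - intros [H0 J0]; repeat split; nra.
  - subst; rewrite Ropp_0, sqrt_0; intros [H0 J0]; repeat split; nra.
Qed.

(** [versine_sol] and [sn_sol] are obtained by solving the system
    [- 2 * H * u + S * s = J], [2 * H * S - (1 - kappa * u) * s = D], linear in [u]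
    and [S]; the relation [S ^ 2 = u * (2 - kappa * u)] then determines [D ^ 2]. *)
Definition denom (kappa H J s : R) : R := sqrt (s ^ 2 - J * (4 * H + kappa * J)).

Definition versine_sol (kappa H J s : R) : R :=
  (s ^ 2 + s * denom kappa H J s - 2 * H * J) / (4 * H ^ 2 + kappa * s ^ 2).

Definition sn_sol (kappa H J s : R) : R :=
  (2 * H * (denom kappa H J s + s) + kappa * s * J) / (4 * H ^ 2 + kappa * s ^ 2).

(** Up to sign this is the determinant of the linear system for [u] and [S]. It is affine in [s ^ 2]
    and positive at both ends of [[0, 1]]. *)
Lemma det_gt0 (kappa H s : R) :
  0 < H -> 0 < 4 * H ^ 2 + kappa -> -1 <= s <= 1 -> 0 < 4 * H ^ 2 + kappa * s ^ 2.
Proof.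
  intros H0 H1 hs; assert (0 <= s ^ 2 <= 1) by nra.
  destruct (Rle_lt_dec 0 kappa); nra.
Qed.

Lemma denom_sqr (kappa H J s : R) : Xi kappa (H, J) ->
  0 < denom kappa H J s /\ denom kappa H J s ^ 2 = s ^ 2 - J * (4 * H + kappa * J).
Proof.
  intros hX; destruct (Xi_pos _ _ _ hX) as [H0 [J0 [K0 K1]]].
  assert (0 < s ^ 2 - J * (4 * H + kappa * J)) by nra.
  split; [now apply sqrt_lt_R0 | apply pow2_sqrt; lra].
Qed.

Lemma lt_of_sqr_lt (x y : R) : 0 <= y -> x ^ 2 < y ^ 2 -> - y < x < y.
Proof. intros; split; nra. Qed.

(** The numerator of [sn_sol] is [2 * H * D + s * (2 * H + kappa * J)], with [D] the value of
    [denom]. The two bounds say that it is positive for [D] and would be negative for [- D], which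
    is what selects the root of [D ^ 2]. *)
Lemma denom_bound (kappa H J s : R) : Xi kappa (H, J) -> -1 <= s <= 1 ->
  - (2 * H * denom kappa H J s) < s * (2 * H + kappa * J) < 2 * H * denom kappa H J s.
Proof.
  intros hX hs; destruct (Xi_pos _ _ _ hX) as [H0 [J0 [K0 K1]]].
  destruct (denom_sqr kappa H J s hX) as [D0 D2].
  set (D := denom kappa H J s) in *.
  assert (hdet := det_gt0 kappa H s H0 K1 hs).
  apply lt_of_sqr_lt; [nra | ].
  replace ((2 * H * D) ^ 2) with (4 * H ^ 2 * D ^ 2) by ring; rewrite D2.
  assert (0 < - J * (4 * H + kappa * J) * (4 * H ^ 2 + kappa * s ^ 2)).
  { repeat apply Rmult_lt_0_compat; lra. }
  nra.
Qed.

Lemma sn_sol_gt0 (kappa H J s : R) : Xi kappa (H, J) -> -1 <= s <= 1 ->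
  0 < sn_sol kappa H J s.
Proof.
  intros hX hs; destruct (Xi_pos _ _ _ hX) as [H0 [J0 [K0 K1]]].
  assert (hb := denom_bound kappa H J s hX hs).
  apply Rdiv_lt_0_compat; [lra | now apply det_gt0].
Qed.

Lemma sn_sol_sqr (kappa H J s : R) : Xi kappa (H, J) -> -1 <= s <= 1 ->
  sn_sol kappa H J s ^ 2
  = versine_sol kappa H J s * (2 - kappa * versine_sol kappa H J s).
Proof.
  intros hX hs; destruct (Xi_pos _ _ _ hX) as [H0 [J0 [K0 K1]]].
  destruct (denom_sqr kappa H J s hX) as [D0 D2].
  assert (hdet := det_gt0 kappa H s H0 K1 hs).
  unfold sn_sol, versine_sol; set (D := denom kappa H J s) in *.
  apply Rminus_diag_uniq.
  (* The two sides differ by a multiple of the relation that determines [D ^ 2]. *)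
  replace (_ - _) with ((D ^ 2 - (s ^ 2 - J * (4 * H + kappa * J))) / (4 * H ^ 2 + kappa * s ^ 2))
    by (field; lra).
  rewrite D2; field; lra.
Qed.

(** Positivity of the numerator comes from [(s ^ 2 - 2 * H * J) ^ 2 - s ^ 2 * D ^ 2 = J ^ 2 * (4 * H
    ^ 2 + kappa * s ^ 2)]; the upper bound then follows from [sn_sol_sqr], whose left side is
    positive. *)
Lemma versine_sol_bounds (kappa H J s : R) : Xi kappa (H, J) -> -1 <= s <= 1 ->
  0 < versine_sol kappa H J s /\ kappa * versine_sol kappa H J s < 2.
Proof.
  intros hX hs; destruct (Xi_pos _ _ _ hX) as [H0 [J0 [K0 K1]]].
  destruct (denom_sqr kappa H J s hX) as [D0 D2].
  assert (hdet := det_gt0 kappa H s H0 K1 hs).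
  assert (hS := sn_sol_gt0 kappa H J s hX hs).
  assert (e := sn_sol_sqr kappa H J s hX hs).
  assert (u0 : 0 < versine_sol kappa H J s).
  { unfold versine_sol; set (D := denom kappa H J s) in *.
    apply Rdiv_lt_0_compat; [ | exact hdet].
    assert (hl : - (s ^ 2 - 2 * H * J) < s * D < s ^ 2 - 2 * H * J).
    { apply lt_of_sqr_lt; [nra | ].
      rewrite Rpow_mult_distr, D2.
      assert (0 < J ^ 2 * (4 * H ^ 2 + kappa * s ^ 2)) by (apply Rmult_lt_0_compat; nra).
      nra. }
    lra. }
  split; [exact u0 | nra].
Qed.

Lemma solution_eq (kappa H J s : R) : Xi kappa (H, J) -> -1 <= s <= 1 ->
  - (2 * H * versine_sol kappa H J s) + sn_sol kappa H J s * s = J /\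
  2 * H * sn_sol kappa H J s - (1 - kappa * versine_sol kappa H J s) * s = denom kappa H J s.
Proof.
  intros hX hs; destruct (Xi_pos _ _ _ hX) as [H0 [J0 [K0 K1]]].
  assert (hdet := det_gt0 kappa H s H0 K1 hs).
  unfold sn_sol, versine_sol; split; field; lra.
Qed.

(** A solution defines [D'] with [D' ^ 2 = D ^ 2]. The choice [D' = - D] would make [S] negative by
    [denom_bound], so [D' = D], and the linear system gives [u]. *)
Lemma solution_unique (kappa H J s u S : R) : Xi kappa (H, J) -> -1 <= s <= 1 ->
  0 < S -> S ^ 2 = u * (2 - kappa * u) -> - (2 * H * u) + S * s = J ->
  u = versine_sol kappa H J s.
Proof.
  intros hX hs S0 S2 e; destruct (Xi_pos _ _ _ hX) as [H0 [J0 [K0 K1]]].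
  assert (hb := denom_bound kappa H J s hX hs).
  destruct (denom_sqr kappa H J s hX) as [D0 D2].
  assert (hdet := det_gt0 kappa H s H0 K1 hs).
  unfold versine_sol; set (D := denom kappa H J s) in *.
  set (D' := 2 * H * S - (1 - kappa * u) * s).
  assert (hD' : D' ^ 2 = D ^ 2).
  { rewrite D2, <- e; unfold D'.
    apply Rminus_diag_uniq.
    replace (_ - _) with ((4 * H ^ 2 + kappa * s ^ 2) * (S ^ 2 - u * (2 - kappa * u))) by ring.
    rewrite S2; ring. }
  assert (hS : S * (4 * H ^ 2 + kappa * s ^ 2) = 2 * H * (D' + s) + kappa * s * J)
    by (rewrite <- e; unfold D'; ring).
  assert (hu : u * (4 * H ^ 2 + kappa * s ^ 2) = s ^ 2 + s * D' - 2 * H * J)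
    by (rewrite <- e; unfold D'; ring).
  assert (hSpos : 0 < S * (4 * H ^ 2 + kappa * s ^ 2)) by (apply Rmult_lt_0_compat; lra).
  assert (eD : D' = D).
  { assert (hf : (D' - D) * (D' + D) = 0) by (clearbody D'; nra).
    apply Rmult_integral in hf; destruct hf as [hf | hf]; [lra | exfalso].
    replace D' with (- D) in hS by lra.
    assert (2 * H * (- D + s) + kappa * s * J < 0) by lra.
    lra. }
  rewrite eD in hu; apply (Rmult_eq_reg_r (4 * H ^ 2 + kappa * s ^ 2)); [ | lra].
  rewrite hu; field; lra.
Qed.

Lemma radius_spec (kappa H J sigma : R) (r := radius kappa H J sigma) : Xi kappa (H, J) ->
  radii kappa r /\ versine kappa r = versine_sol kappa H J (sin sigma) /\
  sn kappa r = sn_sol kappa H J (sin sigma).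
Proof.
  intros hX; assert (hs := SIN_bound sigma).
  assert (hu : forall r, radii kappa r /\ radius_eq kappa H J sigma r <->
    radii kappa r /\ versine kappa r = versine_sol kappa H J (sin sigma)).
  { intros r'; rewrite radius_eq_versine; split; intros [hr e]; split; auto.
    - apply (solution_unique _ _ _ _ _ (sn kappa r')); auto using sn_gt0, sn_versine.
    - assert (eS : sn kappa r' = sn_sol kappa H J (sin sigma)).
      { assert (h0 := sn_gt0 _ _ hr); assert (h1 := sn_sol_gt0 _ _ _ _ hX hs).
        assert (h2 := sn_versine kappa r'); rewrite e, <- sn_sol_sqr in h2 by auto.
        nra. }
      rewrite e, eS; now apply solution_eq. }
  assert (hr : radii kappa r /\ versine kappa r = versine_sol kappa H J (sin sigma)).
  { apply hu; unfold r, radius.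
    apply (iota_correct (fun x : R => radii kappa x /\ radius_eq kappa H J sigma x)).
    destruct (versine_sol_bounds _ _ _ _ hX hs) as [v0 v1].
    destruct (versine_onto kappa _ v0 v1) as [r' hr'].
    exists r'; split; [now apply hu | ].
    intros x hx; apply hu in hx.
    apply (versine_inj kappa); try tauto; destruct hx, hr'; congruence. }
  destruct hr as [hr e]; repeat split; try apply hr; auto.
  assert (h0 := sn_gt0 _ _ hr); assert (h1 := sn_sol_gt0 _ _ _ _ hX hs).
  assert (h2 := sn_versine kappa r); rewrite e, <- sn_sol_sqr in h2 by auto.
  nra.
Qed.

(** * Integrals of functions of the sine *)

Lemma continuous_ex_RInt (f : R -> R) (x y : R) :
  (forall t, continuous f t) -> ex_RInt f x y.
Proof. intros hf; apply (ex_RInt_continuous (V := R_CompleteNormedModule)); auto. Qed.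

Lemma RInt_split (f : R -> R) (x y z : R) : (forall t, continuous f t) ->
  RInt f x z = RInt f x y + RInt f y z.
Proof.
  intros hf; symmetry.
  apply (RInt_Chasles (V := R_CompleteNormedModule)); now apply continuous_ex_RInt.
Qed.

Lemma RInt_shift (f : R -> R) (c x y : R) : (forall t, continuous f t) ->
  RInt (fun t => f (t + c)) x y = RInt f (x + c) (y + c).
Proof.
  intros hf.
  replace (x + c) with (1 * x + c) by ring; replace (y + c) with (1 * y + c) by ring.
  rewrite <- (RInt_comp_lin (V := R_CompleteNormedModule) f) by now apply continuous_ex_RInt.
  apply RInt_ext; intros t _; unfold scal; simpl; unfold mult; simpl.
  rewrite !Rmult_1_l; reflexivity.
Qed.

Lemma RInt_reflect (f : R -> R) (c x y : R) : (forall t, continuous f t) ->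
  RInt (fun t => f (c - t)) x y = RInt f (c - y) (c - x).
Proof.
  intros hf.
  assert (hg : forall t, continuous (fun t => f (c - t)) t).
  { intros t; apply (continuous_comp (fun t => c - t) f); [ | apply hf].
    apply (ex_derive_continuous (V := R_NormedModule)); auto_derive; auto. }
  rewrite <- (opp_RInt_swap (V := R_CompleteNormedModule) f) by now apply continuous_ex_RInt.
  replace (c - x) with (-1 * x + c) by ring; replace (c - y) with (-1 * y + c) by ring.
  rewrite <- (RInt_comp_lin (V := R_CompleteNormedModule) f) by now apply continuous_ex_RInt.
  rewrite <- (RInt_opp (V := R_CompleteNormedModule)).
  - apply RInt_ext; intros t _; unfold opp, scal; simpl; unfold mult; simpl.
    replace (-1 * t + c) with (c - t) by ring; ring.
  - apply (ex_RInt_ext (fun t => scal (-1) (f (c - t)))).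
    + intros t _; f_equal; f_equal; ring.
    + apply (ex_RInt_scal (V := R_NormedModule)), continuous_ex_RInt, hg.
Qed.

(** The reflection [t -> 2 * PI - t] changes the sign of the sine and folds [[PI, 3 * PI / 2]] onto
    [[PI / 2, PI]]. *)
Lemma RInt_sin_half_period (g : R -> R) : (forall t, continuous (fun t => g (sin t)) t) ->
  RInt (fun t => g (sin t)) (PI / 2) (3 * PI / 2)
  = RInt (fun t => g (sin t) + g (- sin t)) (PI / 2) PI.
Proof.
  intros hg.
  assert (hg' : forall t, continuous (fun t => g (- sin t)) t).
  { intros t; apply (continuous_ext (fun t => g (sin (t + PI)))).
    - intros x; now rewrite neg_sin.
    - apply (continuous_comp (fun t => t + PI) (fun t => g (sin t))); [ | apply hg].
      apply (ex_derive_continuous (V := R_NormedModule)); auto_derive; auto. }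
  rewrite (RInt_split _ _ PI) by exact hg.
  replace (RInt _ PI (3 * PI / 2)) with (RInt (fun t => g (- sin t)) (PI / 2) PI).
  - symmetry; apply (RInt_plus (V := R_CompleteNormedModule)); now apply continuous_ex_RInt.
  - transitivity (RInt (fun t => g (sin t)) (2 * PI - PI) (2 * PI - PI / 2));
      [ | f_equal; field].
    rewrite <- (RInt_reflect (fun t => g (sin t))) by exact hg.
    apply RInt_ext; intros t _; f_equal.
    replace (2 * PI - t) with (- t + 2 * PI) by ring.
    now rewrite sin_plus, cos_2PI, sin_2PI, sin_neg, Rmult_0_r, Rplus_0_r, Rmult_1_r.
Qed.

(** The integrand is symmetric about [3 * PI / 2], so a vanishing integral over
    the half period makes the primitive periodic. *)
Lemma RInt_sin_periodic (g : R -> R) (x : R) :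
  (forall t, continuous (fun t => g (sin t)) t) ->
  RInt (fun t => g (sin t)) (PI / 2) (3 * PI / 2) = 0 ->
  RInt (fun t => g (sin t)) (PI / 2) (x + 2 * PI)
  = RInt (fun t => g (sin t)) (PI / 2) x.
Proof.
  intros hg h0.
  rewrite (RInt_split _ _ (3 * PI / 2)), h0 by exact hg.
  rewrite (RInt_split _ _ (PI / 2 + 2 * PI)), <- RInt_shift by exact hg.
  replace (RInt _ (3 * PI / 2) (PI / 2 + 2 * PI)) with 0.
  - rewrite !Rplus_0_l; apply RInt_ext; intros t _.
    now rewrite sin_plus, cos_2PI, sin_2PI, Rmult_0_r, Rplus_0_r, Rmult_1_r.
  - transitivity (RInt (fun t => g (sin t)) (3 * PI - 3 * PI / 2) (3 * PI - PI / 2));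
      [ | f_equal; field].
    rewrite <- (RInt_reflect (fun t => g (sin t))) by exact hg.
    rewrite <- h0 at 1; apply RInt_ext; intros t _; f_equal.
    replace (3 * PI - t) with (PI - t + 2 * PI) by ring.
    rewrite sin_plus, cos_2PI, sin_2PI, Rmult_0_r, Rplus_0_r, Rmult_1_r.
    symmetry; apply sin_PI_x.
Qed.

Lemma periodic_reduce (f : R -> R) (c : R) :
  (forall x, f (x + 2 * PI) = f x) ->
  forall x, exists y, c <= y <= c + 2 * PI /\ f x = f y.
Proof.
  intros hf x.
  assert (hn : forall n x, f (x + 2 * PI * INR n) = f x).
  { induction n as [ | n IH]; intros z.
    - simpl; f_equal; ring.
    - rewrite S_INR, <- (IH z), <- (hf (z + 2 * PI * INR n)); f_equal; ring. }
  assert (p0 := PI_RGT_0).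
  destruct (floor_ex ((x - c) / (2 * PI))) as [n [n0 n1]].
  set (q := (x - c) / (2 * PI)) in *.
  assert (ex : x = c + 2 * PI * q) by (unfold q; field; lra).
  exists (x - 2 * PI * IZR n); split; [rewrite ex; nra | ].
  destruct (Z_le_gt_dec 0 n) as [hz | hz].
  - rewrite <- (hn (Z.to_nat n) (x - 2 * PI * IZR n)), INR_IZR_INZ, Z2Nat.id by exact hz; f_equal; ring.
  - rewrite <- (hn (Z.to_nat (- n)) x), INR_IZR_INZ, Z2Nat.id, opp_IZR by lia.
    f_equal; ring.
Qed.

(** By periodicity the endpoint can be moved to within [2 * PI] of [PI / 2], which makes the bound
    independent of [x]. *)
Lemma RInt_sin_bound (g : R -> R) (M x : R) :
  (forall t, continuous (fun t => g (sin t)) t) ->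
  RInt (fun t => g (sin t)) (PI / 2) (3 * PI / 2) = 0 ->
  (forall s, -1 <= s <= 1 -> Rabs (g s) <= M) ->
  Rabs (RInt (fun t => g (sin t)) (PI / 2) x) <= 2 * PI * M.
Proof.
  intros hg h0 hM.
  destruct (periodic_reduce (fun x => RInt (fun t => g (sin t)) (PI / 2) x) (PI / 2))
    with (x := x) as [y [hy ->]].
  { intros z; now apply RInt_sin_periodic. }
  apply Rle_trans with ((y - PI / 2) * M).
  - apply abs_RInt_le_const; [lra | now apply continuous_ex_RInt | ].
    intros t _; apply hM, SIN_bound.
  - apply Rmult_le_compat_r; [ | lra].
    apply Rle_trans with (Rabs (g 0)); [apply Rabs_pos | apply hM; lra].
Qed.

(** * The slope of the height and the closing condition *)

(** The squared length under [metric] of the orbit velocity [(0, 1, a)], at a radius with versine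
    [u]. *)
Definition speed_sqr (kappa tau a u : R) : R := u * (2 - kappa * u) + (2 * tau * u - a) ^ 2.

Definition slope (kappa tau a H J s : R) : R :=
  sqrt (speed_sqr kappa tau a (versine_sol kappa H J s)) / denom kappa H J s * s.

Lemma dh_slope (kappa tau a H J sigma : R) : Xi kappa (H, J) ->
  dh kappa tau a H J sigma = slope kappa tau a H J (sin sigma).
Proof.
  intros hX; assert (hs := SIN_bound sigma).
  destruct (radius_spec kappa H J sigma hX) as [hr [hv hS]].
  unfold dh, slope; set (r := radius kappa H J sigma) in *; cbv zeta.
  destruct (solution_eq _ _ _ _ hX hs) as [_ e]; rewrite <- e.
  rewrite cs_versine, hv, hS.
  replace (4 * tau * sn kappa (r / 2) ^ 2) with (2 * tau * versine kappa r)
    by (unfold versine; ring).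
  rewrite hv, sn_sol_sqr by auto; reflexivity.
Qed.

Lemma speed_sqr_gt0 (kappa tau a H J s : R) : Xi kappa (H, J) -> -1 <= s <= 1 ->
  0 < speed_sqr kappa tau a (versine_sol kappa H J s).
Proof.
  intros hX hs; destruct (versine_sol_bounds _ _ _ _ hX hs) as [v0 v1].
  unfold speed_sqr; apply Rplus_lt_le_0_compat; [ | apply pow2_ge_0].
  apply Rmult_lt_0_compat; lra.
Qed.

Lemma slope_continuous (kappa tau a H J t : R) : Xi kappa (H, J) ->
  continuous (fun t => slope kappa tau a H J (sin t)) t.
Proof.
  intros hX; assert (hs := SIN_bound t).
  assert (hG := speed_sqr_gt0 _ tau a _ _ _ hX hs).
  destruct (denom_sqr _ _ _ (sin t) hX) as [D0 D2].
  destruct (Xi_pos _ _ _ hX) as [H0 [J0 [K0 K1]]].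
  assert (hdet := det_gt0 kappa H _ H0 K1 hs).
  assert (hP : 0 < sin t ^ 2 - J * (4 * H + kappa * J)) by nra.
  apply (ex_derive_continuous (V := R_NormedModule)).
  unfold slope, speed_sqr, versine_sol, denom in *.
  auto_derive; repeat split; auto; try lra.
  apply Rgt_not_eq, sqrt_lt_R0; lra.
Qed.

(** If the bound failed, then for all [s] the mean of the versines at [s] and [- s]
    would lie strictly on one side of the vertex [u0] of [speed_sqr], and [dh sigma +
    dh (2 * PI - sigma)] would have constant sign. *)
Lemma tube_region_bound (kappa tau a H J u0 : R) :
  kappa <> 4 * tau ^ 2 -> u0 = (1 - 2 * a * tau) / (kappa - 4 * tau ^ 2) ->
  tube_region kappa tau a (H, J) ->
  Rabs (2 * H * J + 4 * H ^ 2 * u0) <= Rabs (1 - kappa * u0).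
Proof.
  intros hk eu0 [hX hd]; simpl in hd.
  destruct (Xi_pos _ _ _ hX) as [H0 [J0 [K0 K1]]].
  (* The mean of the versines at [s] and [- s] exceeds [u0] by [(s ^ 2 * B - E) / (4 * H ^ 2 + kappa
     * s ^ 2)], so its side of [u0] is decided by [E] if [E] dominates [B]. *)
  set (E := 2 * H * J + 4 * H ^ 2 * u0); set (B := 1 - kappa * u0).
  apply Rnot_lt_le; intros hlt.
  unfold defect in hd.
  rewrite (RInt_ext _ (fun t => slope kappa tau a H J (sin t))) in hd
    by (intros t _; now apply dh_slope).
  rewrite RInt_sin_half_period in hd by (intros; now apply slope_continuous).
  (* For [s > 0] the sum of the slopes at [s] and [- s] has the sign of [l]; multiplying by [l]
     treats all sign combinations at once. *)
  set (l := (kappa - 4 * tau ^ 2) * E).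
  assert (hcont : forall t, continuous
    (fun t => slope kappa tau a H J (sin t) + slope kappa tau a H J (- sin t)) t).
  { intros t; apply (continuous_plus (V := R_NormedModule)); [now apply slope_continuous | ].
    apply (continuous_ext (fun t => slope kappa tau a H J (sin (t + PI)))).
    - intros x; now rewrite neg_sin.
    - apply (continuous_comp (fun t => t + PI) (fun t => slope kappa tau a H J (sin t)));
        [ | now apply slope_continuous].
      apply (ex_derive_continuous (V := R_NormedModule)); auto_derive; auto. }
  assert (hpos : 0 < RInt (fun t => l *
    (slope kappa tau a H J (sin t) + slope kappa tau a H J (- sin t))) (PI / 2) PI).
  { assert (p0 := PI_RGT_0).
    apply RInt_gt_0; [lra | | ].
    2: { intros t _; apply (continuous_scal_r l (V := R_NormedModule)); apply hcont. }
    intros t ht.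
    assert (hs0 : 0 < sin t) by (apply sin_gt_0; lra).
    assert (hs := SIN_bound t); set (s := sin t) in *.
    assert (hs' : -1 <= - s <= 1) by lra.
    assert (hG1 := speed_sqr_gt0 _ tau a _ _ _ hX hs).
    assert (hG2 := speed_sqr_gt0 _ tau a _ _ _ hX hs').
    assert (eD : denom kappa H J (- s) = denom kappa H J s)
      by (unfold denom; f_equal; ring).
    assert (hdet := det_gt0 kappa H _ H0 K1 hs).
    destruct (denom_sqr _ _ _ s hX) as [D0 _].
    assert (hdiff : speed_sqr kappa tau a (versine_sol kappa H J s)
      - speed_sqr kappa tau a (versine_sol kappa H J (- s))
      = (kappa - 4 * tau ^ 2) * (E - s ^ 2 * B)
        * (4 * s * denom kappa H J s / (4 * H ^ 2 + kappa * s ^ 2) ^ 2)).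
    { assert (e1 : 1 - 2 * a * tau = u0 * (kappa - 4 * tau ^ 2))
        by (rewrite eu0; field; lra).
      set (D := denom kappa H J s) in *.
      (* The difference of a quadratic at two points is the difference of the points times a factor
         affine in their sum, which vanishes when their mean is the vertex [u0]. *)
      transitivity ((versine_sol kappa H J s - versine_sol kappa H J (- s))
        * (2 * (1 - 2 * a * tau) - (kappa - 4 * tau ^ 2)
           * (versine_sol kappa H J s + versine_sol kappa H J (- s)))).
      { unfold speed_sqr; ring. }
      rewrite e1; unfold versine_sol, E, B; rewrite eD; fold D; field; nra. }
    unfold slope; rewrite eD.
    set (G1 := speed_sqr _ _ _ (versine_sol kappa H J s)) in *.
    set (G2 := speed_sqr _ _ _ (versine_sol kappa H J (- s))) in *.
    set (D := denom kappa H J s) in *.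
    assert (q1 := sqrt_lt_R0 _ hG1); assert (q2 := sqrt_lt_R0 _ hG2).
    assert (r1 := pow2_sqrt G1 ltac:(lra)); assert (r2 := pow2_sqrt G2 ltac:(lra)).
    assert (hl : 0 < l * (G1 - G2)).
    { rewrite hdiff; unfold l.
      replace (_ * _) with ((kappa - 4 * tau ^ 2) ^ 2 * (E * (E - s ^ 2 * B))
        * (4 * s * D / (4 * H ^ 2 + kappa * s ^ 2) ^ 2)) by (field; lra).
      apply Rmult_lt_0_compat; [apply Rmult_lt_0_compat | ].
      - apply pow2_gt_0; lra.
      - assert (0 <= s ^ 2 <= 1) by nra.
        assert (hw : Rabs (s ^ 2 * B) < Rabs E).
        { rewrite Rabs_mult, (Rabs_pos_eq (s ^ 2)) by lra.
          assert (hB := Rabs_pos B); nra. }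
        apply Rabs_lt_between in hw; revert hw; unfold Rabs.
        destruct (Rcase_abs E); intros; nra.
      - apply Rdiv_lt_0_compat; [repeat apply Rmult_lt_0_compat; lra | now apply pow_lt]. }
    (* Rationalizing [sqrt G1 - sqrt G2]. *)
    replace (l * _) with (l * (G1 - G2) * (s / (D * (sqrt G1 + sqrt G2)))).
    - apply Rmult_lt_0_compat; [exact hl | apply Rdiv_lt_0_compat; [lra | ]].
      apply Rmult_lt_0_compat; lra.
    - rewrite <- r1, <- r2 at 1; field; lra. }
  rewrite (RInt_scal (V := R_CompleteNormedModule)) in hpos
    by now apply continuous_ex_RInt.
  rewrite hd in hpos; unfold scal in hpos; simpl in hpos; unfold mult in hpos; simpl in hpos.
  lra.
Qed.

(** * Asymptotics of tubes for large mean curvature *)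

Lemma abs_mult_le (x y X Y : R) : Rabs x <= X -> Rabs y <= Y -> Rabs (x * y) <= X * Y.
Proof. intros; rewrite Rabs_mult; apply Rmult_le_compat; auto using Rabs_pos. Qed.

Lemma abs_plus_le (x y X Y : R) : Rabs x <= X -> Rabs y <= Y -> Rabs (x + y) <= X + Y.
Proof. intros; eapply Rle_trans; [apply Rabs_triang | lra]. Qed.

(** The closing bound keeps [J + 2 * H * u0] bounded, so [denom] grows exactly like [H]. This
    controls both the deviation of the versine from [u0] and the quotient in [slope]. *)
Lemma tube_region_asymptotics (kappa tau a u0 : R) :
  kappa <> 4 * tau ^ 2 -> u0 = (1 - 2 * a * tau) / (kappa - 4 * tau ^ 2) ->
  0 < u0 -> kappa * u0 < 2 ->
  exists C H1, 0 < C /\ 0 < H1 /\ forall H J s, H1 <= H ->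
    tube_region kappa tau a (H, J) -> -1 <= s <= 1 ->
    Rabs (versine_sol kappa H J s - u0) <= C / H /\
    Rabs (slope kappa tau a H J s) <= C / H.
Proof.
  intros hk eu0 u0pos u0lt.
  set (k := Rabs kappa); assert (hk0 : 0 <= k) by apply Rabs_pos.
  assert (hkk : - k <= kappa <= k) by (apply Rabs_le_between; unfold k; lra).
  set (b := Rabs (1 - kappa * u0)); assert (hb0 : 0 <= b) by apply Rabs_pos.
  assert (hbb : - b <= 1 - kappa * u0 <= b) by (apply Rabs_le_between; unfold b; lra).
  (* The squared [sn] at the radius with versine [u0]. *)
  set (S0 := u0 * (2 - kappa * u0)).
  assert (hS0 : 0 < S0) by (apply Rmult_lt_0_compat; lra).
  (* For large [H], [A * H] bounds [J], [K * H] bounds [denom], [C1 / H] the deviation of the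
     versine from [u0], [U] the versine and [M] the squared speed. *)
  set (A := 2 * u0 + b).
  set (K := 1 + A * (4 + k * A)).
  assert (hA : 0 < A) by (unfold A; lra).
  assert (hkA : 0 <= k * A) by (apply Rmult_le_pos; lra).
  assert (hK : 1 <= K) by (unfold K; nra).
  set (C1 := 2 * b + K).
  set (U := u0 + C1).
  set (M := U * (2 + k * U) + (2 * Rabs tau * U + Rabs a) ^ 2).
  assert (hU : 0 < U) by (unfold U, C1; lra).
  assert (hM : 0 < M).
  { apply Rplus_lt_le_0_compat; [ | apply pow2_ge_0].
    apply Rmult_lt_0_compat; [lra | nra]. }
  assert (hqM := sqrt_lt_R0 _ hM); assert (hqS := sqrt_lt_R0 _ hS0).
  assert (hC2 : 0 < sqrt M / sqrt S0) by now apply Rdiv_lt_0_compat.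
  assert (hL : 0 <= (2 + k) * b ^ 2 / S0).
  { apply Rmult_le_pos; [ | left; now apply Rinv_0_lt_compat].
    apply Rmult_le_pos; [lra | apply pow2_ge_0]. }
  (* The threshold ensures [1 <= H], [k <= H] and [(2 + k) * b ^ 2 <= H * S0]. *)
  exists (C1 + sqrt M / sqrt S0), (1 + k + (2 + k) * b ^ 2 / S0).
  split; [unfold C1; lra | split; [lra | ]].
  intros H J s hH hT hs.
  assert (hX := proj1 hT).
  assert (hE := tube_region_bound _ _ _ _ _ _ hk eu0 hT); fold b in hE.
  set (E := 2 * H * J + 4 * H ^ 2 * u0) in *.
  assert (hEb := proj1 (Rabs_le_between _ _) hE).
  assert (H1 : 1 <= H) by lra.
  assert (Hk : k <= H) by lra.
  set (x := J + 2 * H * u0).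
  assert (ex : E = 2 * H * x) by (unfold E, x; ring).
  assert (hx : - b <= x <= b) by nra.
  assert (hJ : - (A * H) <= J <= A * H) by (unfold x, A in *; nra).
  assert (hs2 : 0 <= s ^ 2 <= 1) by nra.
  destruct (denom_sqr _ _ _ s hX) as [D0 D2].
  assert (hH2 : 0 < H ^ 2) by (apply pow_lt; lra).
  assert (hks : - k <= kappa * s ^ 2).
  { assert (0 <= (kappa + k) * s ^ 2) by (apply Rmult_le_pos; lra).
    assert (0 <= k * (1 - s ^ 2)) by (apply Rmult_le_pos; lra); lra. }
  assert (hHH : H <= H ^ 2).
  { assert (0 <= H * (H - 1)) by (apply Rmult_le_pos; lra); lra. }
  assert (hdet : H ^ 2 <= 4 * H ^ 2 + kappa * s ^ 2) by lra.
  assert (hDle : denom kappa H J s <= K * H).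
  { apply Rsqr_incr_0_var; [ | apply Rmult_le_pos; lra].
    unfold Rsqr; replace (_ * _) with (denom kappa H J s ^ 2) by ring; rewrite D2.
    assert (hJa : Rabs J <= A * H) by (apply Rabs_le_between; lra).
    assert (hp : Rabs (J * (4 * H + kappa * J)) <= (A * H) * (4 * H + k * (A * H))).
    { apply abs_mult_le, abs_plus_le; [exact hJa | apply Rabs_le_between; lra | ].
      apply abs_mult_le; [apply Rle_refl | exact hJa]. }
    apply Rabs_le_between in hp.
    apply Rle_trans with (K * H ^ 2); [unfold K; lra | ].
    assert (0 <= K * (K - 1) * H ^ 2) by (repeat apply Rmult_le_pos; lra); lra. }
  assert (hDge : sqrt S0 * H <= denom kappa H J s).
  { apply Rsqr_incr_0_var; [ | lra].
    unfold Rsqr.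
    replace (_ * _) with (sqrt S0 ^ 2 * H ^ 2) by ring; rewrite pow2_sqrt by lra.
    replace (denom _ _ _ _ * denom _ _ _ _) with (denom kappa H J s ^ 2) by ring; rewrite D2.
    (* Substituting [J = x - 2 * H * u0] isolates the leading term [4 * H ^ 2 * S0]; the other terms
       stay bounded, since [E] and [x] are bounded by [b]. *)
    replace (s ^ 2 - _) with
      (s ^ 2 + 4 * H ^ 2 * S0 - 2 * E * (1 - kappa * u0) - kappa * x ^ 2)
      by (unfold S0, E, x; ring).
    assert (hE1 : E * (1 - kappa * u0) <= b ^ 2).
    { assert (h := abs_mult_le _ _ _ _ hE (Rle_refl (Rabs (1 - kappa * u0)))).
      apply Rabs_le_between in h; fold b in h; lra. }
    assert (hx1 : kappa * x ^ 2 <= k * b ^ 2) by 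
      (rewrite <- (pow2_abs x); apply Rle_trans with (k * Rabs x ^ 2);
       [apply Rmult_le_compat_r; [apply pow2_ge_0 | lra]
       | apply Rmult_le_compat_l, pow_incr; [lra | split; [apply Rabs_pos | now apply Rabs_le_between]]]).
    assert (hS : (2 + k) * b ^ 2 <= H * S0).
    { replace ((2 + k) * b ^ 2) with ((2 + k) * b ^ 2 / S0 * S0) by (field; lra).
      apply Rmult_le_compat_r; lra. }
    assert (hS' : 0 <= H * (H - 1) * S0) by (repeat apply Rmult_le_pos; lra).
    assert (hS'' : 0 <= H * S0) by (apply Rmult_le_pos; lra).
    lra. }
  assert (hv : Rabs (versine_sol kappa H J s - u0) <= C1 / H).
  { unfold versine_sol.
    (* The terms of order [H ^ 2] cancel up to [E], leaving a numerator of order [H] over a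
       denominator of at least [H ^ 2]. *)
    replace (_ - u0) with ((s ^ 2 * (1 - kappa * u0) + s * denom kappa H J s - E)
      / (4 * H ^ 2 + kappa * s ^ 2)) by (unfold E; field; lra).
    unfold Rdiv; rewrite Rabs_mult, Rabs_inv, (Rabs_pos_eq (4 * _ + _)) by lra.
    apply Rle_trans with ((2 * b + K * H) * / (H ^ 2)).
    - apply Rmult_le_compat; [apply Rabs_pos | left; apply Rinv_0_lt_compat; lra | | ].
      + replace (2 * b + K * H) with (1 * b + 1 * (K * H) + b) by ring.
        repeat apply abs_plus_le.
        * apply abs_mult_le; [rewrite Rabs_pos_eq; lra | apply Rle_refl].
        * apply abs_mult_le; [apply Rabs_le_between; lra | rewrite Rabs_pos_eq; lra].
        * rewrite Rabs_Ropp; exact hE.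
      + now apply Rinv_le_contravar.
    - replace (C1 * / H) with (C1 * H * / H ^ 2) by (field; lra).
      apply Rmult_le_compat_r; [left; now apply Rinv_0_lt_compat | ].
      assert (0 <= b * (H - 1)) by (apply Rmult_le_pos; lra); unfold C1; lra. }
  assert (hC1 : 0 <= C1) by (unfold C1; lra).
  assert (hinv : 0 < / H <= 1).
  { split; [apply Rinv_0_lt_compat; lra | ].
    rewrite <- Rinv_1; apply Rinv_le_contravar; lra. }
  assert (hCH : 0 < sqrt M / sqrt S0 * / H) by (apply Rmult_lt_0_compat; lra).
  unfold Rdiv at 1 3; rewrite Rmult_plus_distr_r; split.
  { eapply Rle_trans; [exact hv | unfold Rdiv at 1; lra]. }
  assert (hvU : Rabs (versine_sol kappa H J s) <= U).
  { replace (versine_sol kappa H J s) with (u0 + (versine_sol kappa H J s - u0)) by ring.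
    apply abs_plus_le; [rewrite Rabs_pos_eq; lra | ].
    eapply Rle_trans; [exact hv | ].
    rewrite <- (Rmult_1_r C1) at 2; apply Rmult_le_compat_l; lra. }
  assert (hG : speed_sqr kappa tau a (versine_sol kappa H J s) <= M).
  { unfold speed_sqr, M; set (u := versine_sol kappa H J s) in *.
    apply Rplus_le_compat.
    - eapply Rle_trans; [apply Rle_abs | ].
      apply abs_mult_le; [exact hvU | ].
      apply abs_plus_le; [rewrite Rabs_pos_eq; lra | ].
      rewrite Rabs_Ropp; apply abs_mult_le; [apply Rle_refl | exact hvU].
    - rewrite <- (pow2_abs (_ - a)).
      apply pow_incr; split; [apply Rabs_pos | ].
      apply abs_plus_le; [ | rewrite Rabs_Ropp; lra].
      apply abs_mult_le; [ | exact hvU].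
      rewrite Rabs_mult, (Rabs_pos_eq 2); lra. }
  assert (hslope : Rabs (slope kappa tau a H J s) <= sqrt M / sqrt S0 * / H).
  { unfold slope, Rdiv.
    replace (sqrt M * / sqrt S0 * / H) with (sqrt M * / (sqrt S0 * H) * 1) by (field; lra).
    apply abs_mult_le; [apply abs_mult_le | apply Rabs_le_between; lra].
    - rewrite Rabs_pos_eq by apply sqrt_pos; now apply sqrt_le_1_alt.
    - rewrite Rabs_pos_eq by (left; now apply Rinv_0_lt_compat).
      apply Rinv_le_contravar; [apply Rmult_lt_0_compat; lra | exact hDge]. }
  assert (0 <= C1 * / H) by (apply Rmult_le_pos; lra); lra.
Qed.

(** * Distance estimates and control of the radius by its versine *)

(** The coordinate segment has constant angle, so [metric] is Euclidean along it and its length is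
    that of the hypotenuse. *)
Lemma dist_same_angle (kappa tau r rho theta z w : R) :
  radii kappa r -> radii kappa rho ->
  Rbar_le (Defs.dist kappa tau (r, theta, z) (rho, theta, w)) (Rabs (rho - r) + Rabs (w - z)).
Proof.
  intros hr hrho.
  apply Rbar_le_trans with (Finite (sqrt ((rho - r) ^ 2 + (w - z) ^ 2))).
  - apply (proj1 (Glb_Rbar_correct _)).
    exists (fun t => r + t * (rho - r)), (fun _ => theta), (fun t => z + t * (w - z)).
    assert (hC1 : forall x y, C1_on_unit (fun t => x + t * y) /\
      forall t, Derive (fun t => x + t * y) t = y).
    { intros x y.
      assert (hd : forall t, is_derive (fun t => x + t * y) t y)
        by (intros t; auto_derive; [exact I | ring]).
      assert (hD : forall t, Derive (fun t => x + t * y) t = y)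
        by (intros t; now apply is_derive_unique).
      split; [ | exact hD].
      intros t _; split; [now exists y | ].
      apply (continuous_ext (fun _ => y)); [intros; now rewrite hD | apply continuous_const]. }
    assert (hcst : forall t, Derive (fun _ => theta) t = 0) by (intros; apply Derive_const).
    split; [ | unfold length; symmetry].
    + split; [apply hC1 | split; [ | split; [apply hC1 | split; [ | split]]]].
      * intros t _; split; [apply ex_derive_const | ].
        apply (continuous_ext (fun _ => 0)); [intros; now rewrite hcst | apply continuous_const].
      * intros t ht; destruct hr as [r0 r1], hrho as [p0 p1]; cbv beta.
        assert (hm : Rmin r rho <= r + t * (rho - r) <= Rmax r rho)
          by (unfold Rmin, Rmax; destruct (Rle_dec r rho); nra).
        split; [apply Rlt_le_trans with (Rmin r rho); [now apply Rmin_glb_lt | lra] | ].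
        intros hk; apply Rle_lt_trans with (Rmax r rho); [lra | apply Rmax_lub_lt; auto].
      * f_equal; [f_equal | ]; ring.
      * exists 0%Z; f_equal; [f_equal | ]; ring.
    + rewrite (RInt_ext _ (fun _ => sqrt ((rho - r) ^ 2 + (w - z) ^ 2))).
      * rewrite (RInt_const (V := R_CompleteNormedModule)).
        unfold scal; simpl; unfold mult; simpl; ring.
      * intros t _; rewrite hcst, !(proj2 (hC1 _ _)); unfold metric; f_equal; ring.
  - unfold Rbar_le; rewrite <- (sqrt_pow2 (Rabs (rho - r) + Rabs (w - z))) by (apply Rplus_le_le_0_compat; apply Rabs_pos).
    apply sqrt_le_1_alt.
    rewrite <- (pow2_abs (rho - r)), <- (pow2_abs (w - z)).
    assert (h1 := Rabs_pos (rho - r)); assert (h2 := Rabs_pos (w - z)); nra.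
Qed.

Lemma radii_open (kappa rho eps : R) : 0 < eps -> radii kappa rho ->
  exists e, 0 < e < eps /\ radii kappa (rho - e) /\ radii kappa (rho + e).
Proof.
  intros he [p0 p1].
  (* The room left above [rho]; 1 is an arbitrary choice where the interval is unbounded. *)
  set (m := if Rlt_dec 0 kappa then PI / sqrt kappa - rho else 1).
  assert (hm : 0 < m).
  { unfold m; destruct (Rlt_dec 0 kappa) as [hk | hk]; [specialize (p1 hk); lra | lra]. }
  exists (Rmin eps (Rmin rho m) / 2).
  assert (h0 : 0 < Rmin eps (Rmin rho m)) by (repeat apply Rmin_glb_lt; auto).
  assert (h1 := Rmin_l eps (Rmin rho m)); assert (h2 := Rmin_r eps (Rmin rho m)).
  assert (h3 := Rmin_l rho m); assert (h4 := Rmin_r rho m).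
  repeat split; try lra; intros hk; specialize (p1 hk); try lra.
  unfold m in *; destruct (Rlt_dec 0 kappa); lra.
Qed.

(** Continuity of the inverse of the versine, from monotonicity alone: the values at [rho - e] and
    [rho + e] enclose those that force [r] near [rho]. *)
Lemma versine_close (kappa rho eps : R) : 0 < eps -> radii kappa rho ->
  exists d, 0 < d /\ forall r, radii kappa r ->
    Rabs (versine kappa r - versine kappa rho) < d -> Rabs (r - rho) < eps.
Proof.
  intros he hrho.
  destruct (radii_open kappa rho eps he hrho) as [e [[e0 e1] [hl hr]]].
  assert (ll := versine_lt _ _ _ hl hrho ltac:(lra)).
  assert (lr := versine_lt _ _ _ hrho hr ltac:(lra)).
  set (d := Rmin (versine kappa rho - versine kappa (rho - e))
                 (versine kappa (rho + e) - versine kappa rho)).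
  assert (d1 : d <= _) by apply Rmin_l; assert (d2 : d <= _) by apply Rmin_r.
  exists d; split; [apply Rmin_glb_lt; lra | ].
  intros r hrr h; apply Rabs_lt_between in h; apply Rabs_lt_between.
  split; apply Rnot_le_lt; intros hle.
  - assert (h' := versine_lt _ r (rho - e) hrr hl ltac:(lra)); lra.
  - assert (h' := versine_lt _ (rho + e) r hr hrr ltac:(lra)); lra.
Qed.

(** * The limit radius of an admissible pitch *)

(** The upper bound on the pitch says that [u0] is positive. The lower bound, for positive [kappa],
    gives [kappa * u0 <= 1]; otherwise [kappa * u0 <= 0]. *)
Lemma admissible_versine (kappa tau a : R) (u0 := (1 - 2 * a * tau) / (kappa - 4 * tau ^ 2)) :
  kappa <> 4 * tau ^ 2 -> admissible kappa tau a -> 0 < u0 /\ kappa * u0 < 2.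
Proof.
  intros hk; unfold admissible; cbv zeta; intros [h1 h2].
  assert (e : u0 * (kappa - 4 * tau ^ 2) = 1 - 2 * a * tau) by (unfold u0; field; lra).
  assert (ht := pow2_ge_0 tau).
  destruct (Rtotal_order (kappa - 4 * tau ^ 2) 0) as [hn | [hz | hp]]; [ | lra | ].
  - rewrite sign_eq_m1 in h1, h2 by exact hn.
    assert (u0pos : 0 < u0) by nra; split; [exact u0pos | ].
    destruct (Rle_lt_dec kappa 0) as [hk0 | hk0]; [nra | ].
    specialize (h1 hk0); apply (Rmult_le_compat_l kappa) in h1; [ | lra].
    replace (kappa * (2 * tau ^ 2 * -1 / kappa)) with (- (2 * tau ^ 2)) in h1 by (field; lra).
    assert (he : kappa * u0 * (kappa - 4 * tau ^ 2) = kappa * (1 - 2 * a * tau))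
      by (rewrite <- e; ring).
    nra.
  - rewrite sign_eq_1 in h1, h2 by lra.
    assert (u0pos : 0 < u0) by nra; split; [exact u0pos | ].
    assert (hk0 : 0 < kappa) by lra.
    specialize (h1 hk0); apply (Rmult_le_compat_l kappa) in h1; [ | lra].
    replace (kappa * (2 * tau ^ 2 * 1 / kappa)) with (2 * tau ^ 2) in h1 by (field; lra).
    assert (he : kappa * u0 * (kappa - 4 * tau ^ 2) = kappa * (1 - 2 * a * tau))
      by (rewrite <- e; ring).
    nra.
Qed.

Lemma is_rho_versine (kappa tau a rho : R) : kappa <> 4 * tau ^ 2 -> radii kappa rho ->
  versine kappa rho = (1 - 2 * a * tau) / (kappa - 4 * tau ^ 2) -> is_rho kappa tau a rho.
Proof.
  intros hk hr e; split; [exact hr | ].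
  destruct (Req_EM_T kappa 0) as [e0 | hk0].
  - subst kappa.
    assert (ht : tau <> 0) by (intros ->; apply hk; ring).
    replace (rho ^ 2) with (2 * versine 0 rho).
    + rewrite e; field; lra.
    + rewrite versine_flat; field.
  - rewrite cs_versine, e; field; lra.
Qed.

(** * Convergence of the tube family to the geodesic *)

Theorem lemma3p9 (kappa tau a : R) (H J : R -> R)
  (tau_ge0 : 0 <= tau) (kappa_ne : kappa <> 4 * tau ^ 2)
  (a_admissible : admissible kappa tau a)
  (T_tube_family : tube_family kappa tau a H J) :
  exists rho : R,
    is_rho kappa tau a rho /\ converges_in_distance kappa tau a H J rho.
Proof.
  destruct (admissible_versine _ _ _ kappa_ne a_admissible) as [u0 u1].
  (* The limit radius is the one whose versine is the vertex of [speed_sqr]. *)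
  destruct (versine_onto _ _ u0 u1) as [rho [hrho hv]].
  exists rho; split; [now apply is_rho_versine | ].
  destruct (tube_region_asymptotics _ _ _ _ kappa_ne eq_refl u0 u1)
    as [C [H1 [hC [hH1 hasym]]]].
  rewrite <- hv in hasym.
  assert (p0 := PI_RGT_0).
  assert (key : forall eps, 0 < eps -> Rbar_locally p_infty (fun mu => forall sigma,
    radii kappa (radius kappa (H mu) (J mu) sigma) /\
    Rabs (radius kappa (H mu) (J mu) sigma - rho) < eps /\
    Rabs (height kappa tau a (H mu) (J mu) sigma) < eps)).
  { intros eps he.
    destruct (versine_close kappa rho eps he hrho) as [d [d0 hd]].
    assert (hlim := proj2 (is_lim_spec _ _ _) (tube_family_lim_H _ _ _ _ _ T_tube_family)).
    (* The three summands make the asymptotics applicable, bring the versine within [d], and the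
       height below [eps]. *)
    destruct (hlim (H1 + C / d + 2 * PI * C / eps)) as [N hN].
    (* The 0 guarantees [mu > 0], where the surfaces are tubes. *)
    exists (Rmax N 0); intros mu hmu sigma.
    assert (hmu1 := Rmax_l N 0); assert (hmu2 := Rmax_r N 0).
    specialize (hN mu ltac:(lra)).
    assert (hT := tube_family_tube _ _ _ _ _ T_tube_family mu ltac:(lra)).
    set (h := H mu) in *; set (j := J mu) in *.
    assert (q1 : 0 < C / d) by now apply Rdiv_lt_0_compat.
    assert (q2 : 0 < 2 * PI * C / eps) by (apply Rdiv_lt_0_compat; nra).
    assert (hCd : C / h < d).
    { apply Rmult_lt_reg_r with h; [lra | ].
      replace (C / h * h) with (C / d * d) by (field; lra).
      rewrite Rmult_comm; apply Rmult_lt_compat_l; lra. }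
    assert (hCe : 2 * PI * (C / h) < eps).
    { apply Rmult_lt_reg_r with h; [lra | ].
      replace (2 * PI * (C / h) * h) with (2 * PI * C / eps * eps) by (field; lra).
      rewrite Rmult_comm; apply Rmult_lt_compat_l; lra. }
    assert (hX := proj1 hT); assert (hdef := proj2 hT); simpl in hdef.
    assert (hext : forall x y, RInt (dh kappa tau a h j) x y
      = RInt (fun t => slope kappa tau a h j (sin t)) x y).
    { intros x y; apply RInt_ext; intros t _; now apply dh_slope. }
    destruct (radius_spec kappa h j sigma hX) as [hr [hvr _]].
    split; [exact hr | split].
    - apply hd; [exact hr | ]; rewrite hvr.
      eapply Rle_lt_trans; [ | exact hCd].
      apply hasym; [lra | exact hT | apply SIN_bound].
    - unfold height; rewrite hext; unfold defect in hdef; rewrite hext in hdef.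
      eapply Rle_lt_trans; [ | exact hCe].
      apply RInt_sin_bound; [intros; now apply slope_continuous | exact hdef | ].
      intros s hs; apply hasym; [lra | exact hT | exact hs]. }
  split.
  - intros eps; generalize (key eps (cond_pos eps)).
    apply filter_imp; intros mu hmu sigma; destruct (hmu sigma) as [_ [h1 h2]].
    split; [exact h1 | ].
    change (Rabs (height kappa tau a (H mu) (J mu) sigma - 0) < eps).
    now rewrite Rminus_0_r.
  - intros eps; assert (he := cond_pos eps).
    generalize (key (eps / 2) ltac:(lra)).
    apply filter_imp; intros mu hmu p [sigma [s ->]].
    destruct (hmu sigma) as [hr [h1 h2]].
    (* At equal angle the vertical coordinates differ only by the height, so radius and height
       contribute [eps / 2] each. *)
    exists s; unfold helix.
    eapply Rbar_le_lt_trans; [now apply dist_same_angle | simpl].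
    rewrite Rabs_minus_sym.
    replace (a * s - _) with (- height kappa tau a (H mu) (J mu) sigma) by ring.
    rewrite Rabs_Ropp; lra.
Qed.
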